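(* Let $G$ be a connected graph without loops, let $a,b\in V(G)$, and let $\ell\ge 3$ be an integer with $d(a,b)\le\ell$. Then the homomorphism \[ t:(C_\ast(K_\ell(a,b),K'_\ell(a,b)),-\partial)\longrightarrow(MC_{\ast+2,\ell}(a,b),\partial) \] given on the class of a simplex $\{(x_{i_1},i_1),\dots,(x_{i_k},i_k)\}$ of $K_\ell(a,b)$, $i_1<\dots<i_k$, not belonging to $K'_\ell(a,b)$, by \[ [\{(x_{i_1},i_1),\dots,(x_{i_k},i_k)\}]\longmapsto(a,x_{i_1},\dots,x_{i_k},b), \] is a chain map. Furthermore, it is an isomorphism in every degree $\ast\ge 0$.
   Context: A graph $G$ has a vertex set $V(G)$ and an edge set $E(G)$ of 2-element subsets of $V(G)$ (no loops, no multiple edges; not necessarily finite). $d$ is the shortest-path distance on $V(G)$. For a tuple $\mathbf{x}=(x_0,\dots,x_k)\in V(G)^{k+1}$ put $\mathrm{L}(\mathbf{x})=\sum_{i=0}^{k-1}d(x_i,x_{i+1})$. Magnitude chain complex: $MC_{k,\ell}(a,b)$ ($k\ge 0$) is the free $\mathbb{Z}$-module generated by the tuples $(x_0,\dots,x_k)\in V(G)^{k+1}$ with $x_0=a$, $x_k=b$, $x_j\ne x_{j+1}$ for all $0\le j\le k-1$, and $\mathrm{L}(x_0,\dots,x_k)=\ell$. The differential is $\partial=\sum_{i=1}^{k-1}(-1)^i\partial_i$, where $\partial_i(x_0,\dots,x_k)=(x_0,\dots,\hat{x}_i,\dots,x_k)$ (removal of $x_i$) if $d(x_{i-1},x_{i+1})=d(x_{i-1},x_i)+d(x_i,x_{i+1})$,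 and $\partial_i(x_0,\dots,x_k)=0$ otherwise. Shift: $MC_{\ast+2,\ell}(a,b)$ is the chain complex $D_\ast$ with $D_i=MC_{i+2,\ell}(a,b)$ for $i\ge 0$ and $D_i=0$ for $i<0$; its differential $D_i\to D_{i-1}$ is that of $MC_{\ast,\ell}(a,b)$ in degree $i+2$ for $i\ge 1$, and is $0$ for $i\le 0$. Paths: a path is a tuple $(x_0,\dots,x_k)\in V(G)^{k+1}$, $k\ge 1$, with $d(x_i,x_{i+1})=1$ for all $0\le i\le k-1$. $P_{\le\ell}(a,b)$ is the set of paths $(x_0,\dots,x_k)$ with $x_0=a$, $x_k=b$ and $k\le\ell$. Simplicial complexes: a simplicial complex is a set of nonempty finite sets closed under taking nonempty subsets. $K_\ell(a,b)$ is the simplicial complex whose simplices are the nonempty subsets $\{(x_{i_1},i_1),\dots,(x_{i_k},i_k)\}\subset V(G)\times\{1,\dots,\ell-1\}$, $i_1<\dots<i_k$, for which there is a path $(a,x_1,\dots,x_{\ell'-1},b)\in P_{\le\ell}(a,b)$ (of some length $\ell'\le\ell$, with $i_k\le\ell'-1$) having the vertex $x_{i_s}$ in position $i_s$ for each $1\le s\le k$. $K'_\ell(a,b)\subset K_\ell(a,b)$ is the subcomplex of those simplices $\{(x_{i_1},i_1),\dots,(x_{i_k},i_k)\}$, $i_1<\dots<i_k$, with $\mathrm{L}(a,x_{i_1},\dots,x_{i_k},b)\le\ell-1$. Simplicial chains: fix a total order on $V(G)\times\{1,\dots,\ell-1\}$ such that $(x,i)<(y,j)$ whenever $i<j$. For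 a simplicial complex $S$ with vertices in this set, $C_n(S)$ is the free $\mathbb{Z}$-module on simplices with $n+1$ elements ($n\ge 0$), with $\partial\{s_0<\dots<s_n\}=\sum_{i=0}^n(-1)^i\{s_0,\dots,\hat{s}_i,\dots,s_n\}$ for $n\ge 1$ and $\partial=0$ on $C_0(S)$. For a subcomplex $S'$, $C_\ast(S,S')=C_\ast(S)/C_\ast(S')$, and $-\partial$ means its differential with opposite sign. *)

(* Defs.v *)
From HB Require Import structures.
From mathcomp Require Import all_boot all_order all_algebra finmap.
From mathcomp Require Import generic_quotient ring_quotient.
From mathcomp Require Import boolp.
From mathcomp Require Import freeg zify.

Set Implicit Arguments.
Unset Strict Implicit.
Unset Printing Implicit Defensive.

Import GRing.Theory.
Local Open Scope ring_scope.
Local Open Scope fset_scope.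
Local Open Scope quotient_scope.

(* All complexes below are indexed by nat: they vanish in negative degrees, so
   only the differentials from degree n.+1 to degree n are recorded. *)

Section SimplicialChains.
Variable T : choiceType.

Record scomplex := SComplex {
  simplex :> {fset T} -> Prop;
  simplex_neq0 : forall s, simplex s -> s != fset0;
  simplex_sub : forall s s' : {fset T},
    s' != fset0 -> s' `<=` s -> simplex s -> simplex s' }.

Definition nsimplex (S : scomplex) (n : nat) : choiceType :=
  {s : {fset T} | `[< S s >] && (#|` s| == n.+1)}.

Definition chain (S : scomplex) (n : nat) := {freeg (nsimplex S n) / int}.

Lemma face_proof (S : scomplex) n (s : nsimplex S n.+1) (v : val s) :
  `[< S (val s `\ val v) >] && (#|` val s `\ val v| == n.+1).
Proof.
have /andP[/asboolP Ss /eqP cs] := valP s.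
have cf : #|` val s `\ val v| = n.+1.
  by move: cs; rewrite (cardfsD1 (val v)) (valP v) /= add1n => -[].
rewrite cf eqxx andbT; apply/asboolP; apply: simplex_sub Ss.
  by rewrite -cardfs_gt0 cf.
exact: fsubD1set.
Qed.

Definition face (S : scomplex) n (s : nsimplex S n.+1) (v : val s) :
  nsimplex S n := Sub (val s `\ val v) (face_proof v).

(* [r] is the (non-strict) total order on the vertices. *)
Definition bd_simplex (r : rel T) (S : scomplex) n (s : nsimplex S n.+1) :
    chain S n :=
  \sum_(v : val s)
     (-1) ^+ index (val v) (sort r (enum_fset (val s))) *: << face v >>.

Definition bd (r : rel T) (S : scomplex) n : chain S n.+1 -> chain S n :=
  fglift (@bd_simplex r S n).

(* The copy of C_n(S') in C_n(S): chains all of whose simplices lie in S'. *)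
Definition supported (S S' : scomplex) n : {pred chain S n} :=
  [pred c | all (fun s : nsimplex S n => `[< S' (val s) >]) (dom c)].

Lemma supported_zmod_closed (S S' : scomplex) n :
  zmod_closed (@supported S S' n).
Proof.
split=> [|c c' /allP hc /allP hc']; rewrite inE /=; first by rewrite dom0.
apply/allP => s /domB; rewrite mem_cat => /orP[]; [exact: hc|exact: hc'].
Qed.

HB.instance Definition _ (S S' : scomplex) n :=
  GRing.isZmodClosed.Build (chain S n) (@supported S S' n)
    (@supported_zmod_closed S S' n).

(* {ideal_quot I} is also the quotient of a mere Z-module by a subgroup I. *)
Definition relchain (S S' : scomplex) (n : nat) : zmodType :=
  {ideal_quot (@supported S S' n)}.

Definition cls (S S' : scomplex) n (c : chain S n) : relchain S S' n :=
  \pi_({ideal_quot (@supported S S' n)}) c.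

Definition rel_bd (r : rel T) (S S' : scomplex) n (c : relchain S S' n.+1) :
  relchain S S' n :=
  cls S' (bd r (repr (c : {ideal_quot (@supported S S' n.+1)}))).

HB.instance Definition _ (r : rel T) (S : scomplex) n :=
  GRing.isZmodMorphism.Build (chain S n.+1) (chain S n) (@bd r S n)
    (lift_is_additive (@bd_simplex r S n)).

Lemma cls_is_zmod_morphism (S S' : scomplex) n :
  zmod_morphism (@cls S S' n).
Proof. by move=> c c'; rewrite /cls !piE. Qed.

HB.instance Definition _ (S S' : scomplex) n :=
  GRing.isZmodMorphism.Build (chain S n) (relchain S S' n) (@cls S S' n)
    (@cls_is_zmod_morphism S S' n).

Lemma bd_supported (r : rel T) (S S' : scomplex) n (c : chain S n.+1) :
  c \in @supported S S' n.+1 -> bd r c \in @supported S S' n.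
Proof.
move=> /allP hc; rewrite -[c]freeg_sumE raddf_sum big_seq.
apply: rpred_sum => s /hc /asboolP S's; rewrite /= /bd liftU.
rewrite -[coeff s c]intz scaler_int rpredMz //; apply: rpred_sum => v _.
rewrite -[_ ^+ _]intz scaler_int rpredMz //.
rewrite inE /= domU1 /= andbT; apply/asboolP; apply: simplex_sub S's.
  have /andP[/asboolP Sf _] := face_proof v; exact: simplex_neq0 Sf.
exact: fsubD1set.
Qed.

Lemma rel_bdE (r : rel T) (S S' : scomplex) n (c : chain S n.+1) :
  rel_bd r (cls S' c) = cls S' (bd r c).
Proof.
apply/eqP; rewrite /rel_bd /cls -Quotient.idealrBE -raddfB.
by apply: bd_supported; rewrite Quotient.idealrBE reprK.
Qed.

End SimplicialChains.

(* [adj] symmetric and irreflexive encodes a set of 2-element edges. *)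
Record graph := Graph {
  vertex :> choiceType;
  adj : rel vertex;
  adj_sym : symmetric adj;
  adj_irr : irreflexive adj }.

Definition walk (G : graph) (x y : G) (n : nat) : Prop :=
  exists p : seq G, [/\ path (@adj G) x p, last x p = y & size p = n].

Definition connected (G : graph) : Prop := forall x y : G, exists n, walk x y n.

Section Graph.
Variables (G : graph) (hG : connected G).
Implicit Types (x y z a b : G) (s p : seq G).

Lemma walk_ex x y : exists n, `[< walk x y n >].
Proof. by have [n w] := hG x y; exists n; apply/asboolP. Qed.

Definition dist x y : nat := ex_minn (walk_ex x y).

Lemma dist_triangle x y z : (dist x z <= dist x y + dist y z)%N.
Proof.
rewrite {2}/dist; case: ex_minnP => m /asboolP[p [pp <- <-]] _.
rewrite {2}/dist; case: ex_minnP => n /asboolP[q [qp <- <-]] _.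
rewrite /dist; case: ex_minnP => k _; apply; apply/asboolP.
by exists (p ++ q); rewrite cat_path pp qp last_cat size_cat.
Qed.

Lemma dist_eq0 x y : dist x y = 0%N -> x = y.
Proof.
rewrite /dist; case: ex_minnP => n /asboolP[p [_ <- <-]] _.
by move/size0nil => ->.
Qed.

(* Below, a tuple (x_0, ..., x_k) is a sequence of size k.+1. *)

Definition len s : nat := if s is x :: s' then sumn (pairmap dist x s') else 0%N.

Definition is_mc a b (l k : nat) s : bool :=
  [&& size s == k.+1, head a s == a, last a s == b,
      sorted [rel x y | x != y] s & len s == l].

Definition mc_gen a b l k : choiceType := {s : seq G | is_mc a b l k s}.

Definition MC a b l k := {freeg (mc_gen a b l k) / int}.

Definition omit (i : nat) s : seq G := take i s ++ drop i.+1 s.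

Definition smooth (a : G) (i : nat) s : bool :=
  dist (nth a s i.-1) (nth a s i.+1) ==
  (dist (nth a s i.-1) (nth a s i) + dist (nth a s i) (nth a s i.+1))%N.

Lemma omit_proof a b l k (s : mc_gen a b l k.+1) (i : 'I_k) :
  smooth a i.+1 (val s) -> is_mc a b l k (omit i.+1 (val s)).
Proof.
case: s => s /= /and5P[/eqP ss hs ls os /eqP Ls].
have lti := ltn_ord i.
have [s1 [x [y [z [s2 [es s1i]]]]]] :
    exists s1 x y z s2, s = s1 ++ [:: x, y, z & s2] /\ size s1 = i.
  exists (take i s), (nth a s i), (nth a s i.+1), (nth a s i.+2), (drop i.+3 s).
  rewrite -!drop_nth ?cat_take_drop ?ss ?size_take ?ss; try lia.
  by split=> //; case: ifP; lia.
have -> : omit i.+1 s = s1 ++ [:: x, z & s2].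
  rewrite -(cat_rcons x s1 (z :: s2)).
  rewrite /omit es; congr (_ ++ _); last first.
    by rewrite -2!cat_rcons drop_size_cat ?size_rcons ?s1i.
  by rewrite -[X in take _ X]cat_rcons take_size_cat ?size_rcons ?s1i.
have nthE j t : nth a (s1 ++ t) (size s1 + j) = nth a t j.
  by rewrite nth_cat ltnNge leq_addr addKn.
have := (nthE 0, nthE 1, nthE 2)%N; rewrite addn0 addn1 addn2 => -[[e0 e1] e2].
rewrite /smooth es -s1i /= e0 e1 e2 /=.
move=> /eqP dxz.
move: ss hs ls os Ls; rewrite es !size_cat /= !last_cat /= => ss hs ls.
rewrite /is_mc size_cat last_cat /= ls !sorted_cat_cons /=.
move=> /and4P[-> xy yz ->] Ls.
apply/and4P; split=> //; first by apply/eqP; move: ss; lia.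
- by move: hs; case: (s1).
- rewrite /= !andbT; apply: contra_neq xy => xz; apply: dist_eq0.
  have d0 : dist x z = 0%N.
    rewrite xz /dist; case: ex_minnP => n _ /(_ 0%N); rewrite leqn0 => H.
    by apply/eqP/H/asboolP; exists [::].
  by move: dxz; rewrite d0; lia.
- apply/eqP; rewrite -Ls.
  case: (s1) => [|c s1'] /=; first by rewrite dxz addnA.
  by rewrite !pairmap_cat !sumn_cat /= dxz; lia.
Qed.

(* Here i : 'I_k stands for the removed position i.+1, in {1, ..., k}. *)
Definition mc_face a b l k (s : mc_gen a b l k.+1) (i : 'I_k) : MC a b l k :=
  if @idP (smooth a i.+1 (val s)) is ReflectT h
  then << (Sub (omit i.+1 (val s)) (omit_proof h) : mc_gen a b l k) >> else 0.

Definition mc_bd a b l k : MC a b l k.+1 -> MC a b l k :=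
  fglift (fun s : mc_gen a b l k.+1 =>
    \sum_(i < k) (-1) ^+ i.+1 *: mc_face s i).

Definition is_path a b (l : nat) p : bool :=
  [&& (1 < size p)%N, head a p == a, last a p == b,
      sorted [rel x y | dist x y == 1%N] p & ((size p).-1 <= l)%N].

Definition pos (l : nat) : choiceType := {i : nat | (0 < i < l)%N}.
Definition vtx (l : nat) : choiceType := (G * pos l)%type.

Definition K_simplex a b l (s : {fset vtx l}) : Prop :=
  [/\ s != fset0, {in s &, injective snd} &
      exists2 p : seq G, is_path a b l p &
        forall v, v \in s ->
          (val v.2 < (size p).-1)%N /\ nth a p (val v.2) = v.1].

Lemma K_simplex_neq0 a b l (s : {fset vtx l}) :
  @K_simplex a b l s -> s != fset0.
Proof. by case. Qed.

Lemma K_simplex_sub a b l (s s' : {fset vtx l}) :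
  s' != fset0 -> s' `<=` s -> K_simplex a b s -> K_simplex a b s'.
Proof.
move=> s'0 /fsubsetP ss' [_ inj [p Pp ps]]; split=> //.
  by move=> u v /ss' us /ss' vs; apply: inj.
by exists p => // v /ss'; apply: ps.
Qed.

Definition K a b l : scomplex (vtx l) :=
  SComplex (@K_simplex_neq0 a b l) (@K_simplex_sub a b l).

(* (a, x_{i_1}, ..., x_{i_k}, b) with i_1 < ... < i_k. *)
Definition tuple_of a b l (s : {fset vtx l}) : seq G :=
  a :: rcons [seq v.1 | v <- sort (fun u v : vtx l => val u.2 <= val v.2)%N
                                   (enum_fset s)] b.

Definition K'_simplex a b l (s : {fset vtx l}) : Prop :=
  K_simplex a b s /\ (len (tuple_of a b s) <= l - 1)%N.

Lemma K'_simplex_neq0 a b l (s : {fset vtx l}) :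
  @K'_simplex a b l s -> s != fset0.
Proof. by case=> -[]. Qed.

Lemma len_subseq a b s s' :
  subseq s s' -> (len (a :: rcons s b) <= len (a :: rcons s' b))%N.
Proof.
rewrite /=; elim: s' s a => [|y s' IH] [|x s] a //=.
- move=> _; rewrite addn0; apply: leq_trans (dist_triangle a y b) _.
  by rewrite leq_add2l; have := IH [::] y (sub0seq _); rewrite /= addn0.
- case: eqP => [->|_] ss'; first by rewrite leq_add2l IH.
  apply: leq_trans (IH (x :: s) a ss') _.
  case: (s') => [|z s''] /=; rewrite ?addn0; first exact: dist_triangle.
  by rewrite addnA leq_add2r dist_triangle.
Qed.

Lemma K'_simplex_sub a b l (s s' : {fset vtx l}) :
  s' != fset0 -> s' `<=` s -> K'_simplex a b s -> K'_simplex a b s'.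
Proof.
move=> s'0 ss' [Ks Ls]; split; first exact: K_simplex_sub Ks.
apply: leq_trans Ls; apply/len_subseq/map_subseq.
set le := fun u v : vtx l => _.
have le_total : total le by move=> u v; apply: leq_total.
have le_tr : transitive le by move=> u v w; apply: leq_trans.
have -> : sort le (enum_fset s') = sort le [seq v <- enum_fset s | v \in s'].
  apply/perm_sort_inP.
  - by move=> u v *; apply: le_total.
  - by move=> u v w _ _ _; exact: le_tr.
  - case: Ks => _ inj _ u v us vs uv; apply: inj; rewrite ?(fsubsetP ss') //.
    by apply/val_inj/anti_leq.
  - apply: uniq_perm; rewrite ?filter_uniq ?fset_uniq // => v.
    rewrite mem_filter; apply/idP/andP => [vs|[]//]; split=> //.
    exact: (fsubsetP ss').
by apply: subseq_sort => //; apply: filter_subseq.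
Qed.

Definition K' a b l : scomplex (vtx l) :=
  SComplex (@K'_simplex_neq0 a b l) (@K'_simplex_sub a b l).

Definition sends_simplex_to_tuple a b l
    (t : forall n, {additive relchain (K a b l) (K' a b l) n ->
                    MC a b l n.+2}) : Prop :=
  forall n (s : nsimplex (K a b l) n), ~ K' a b l (val s) ->
  exists2 x : mc_gen a b l n.+2, val x = tuple_of a b (val s) &
    t n (cls (K' a b l) << s >>) = << x >>.

End Graph.

(* Main.v *)
Require Import Defs.
From HB Require Import structures.
From mathcomp Require Import all_boot all_order all_algebra finmap.
From mathcomp Require Import generic_quotient ring_quotient.
From mathcomp Require Import boolp.
From mathcomp Require Import freeg zify.

(* A path through the vertices (x_i, i) of a simplex s of K is 1-Lipschitz in
   the position, so consecutive vertices of (a, x_{i_1}, ..., x_{i_k}, b) are at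
   distance at most the difference of their positions.  Summing, its length is at
   most the length of the path, hence at most l, and length l forces equality
   everywhere: the positions of s are then the partial sums of the consecutive
   distances.  So outside K' the simplex is determined by its tuple, and every
   tuple of length l arises, by concatenating geodesics.  A face of s lies in K'
   exactly when removing that vertex shortens the tuple, that is, when the
   corresponding face vanishes in the magnitude complex. *)

Set Implicit Arguments.
Unset Strict Implicit.
Unset Printing Implicit Defensive.

Import GRing.Theory.
Local Open Scope ring_scope.
Local Open Scope fset_scope.

(** * Distances along paths and their partial sums *)

Lemma scanl_addnDl d k ds :
  scanl addn (d + k)%N ds = map (addn d) (scanl addn k ds).
Proof. by elim: ds k => //= e ds IHs k; rewrite -addnA IHs. Qed.

Section Distance.
Variables (G : graph) (hG : connected G).
Local Notation dist := (dist hG).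

Lemma distxx x : dist x x = 0%N.
Proof.
rewrite /dist; case: ex_minnP => n _ /(_ 0%N); rewrite leqn0 => H.
by apply/eqP/H/asboolP; exists [::].
Qed.

Lemma dist_adj x y : adj x y -> dist x y = 1%N.
Proof.
move=> xy; have: dist x y != 0%N.
  by apply: contraL xy => /eqP/dist_eq0 ->; rewrite adj_irr.
rewrite /dist; case: ex_minnP => n _ /(_ 1%N) H n0.
suff: (n <= 1)%N by lia.
by apply/H/asboolP; exists [:: y]; rewrite /= xy.
Qed.

Lemma geodesic_ex x y : exists p : seq G,
  [/\ path [rel u v | dist u v == 1%N] x p, last x p = y & size p = dist x y].
Proof.
rewrite /dist; case: ex_minnP => n /asboolP[p [xp xpy sp]] _.
exists p; split=> //; apply: sub_path xp => u v /= uv.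
by apply/eqP/dist_adj.
Qed.

Lemma dist_path_nth a x p i j :
    path [rel u v | dist u v == 1%N] x p -> (i <= j)%N -> (j <= size p)%N ->
  (dist (nth a (x :: p) i) (nth a (x :: p) j) <= j - i)%N.
Proof.
move=> xp; elim: j => [|j IH] ij jp.
  by move: ij; rewrite leqn0 => /eqP ->; rewrite distxx.
have [->|ij'] : i = j.+1 \/ (i <= j)%N by lia.
  by rewrite distxx.
apply: leq_trans (dist_triangle hG _ (nth a (x :: p) j) _) _.
have := IH ij' (ltnW jp); move/(pathP a): xp => /(_ j jp) /eqP /= ->; lia.
Qed.

Section Positions.
Variables (f : nat -> G) (N : nat).
Hypothesis f_lip :
  forall i j, (i <= j)%N -> (j <= N)%N -> (dist (f i) (f j) <= j - i)%N.

(** Each distance is at most the increment of position, and the increments telescope. The term [i]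
    stands on the left to avoid truncated subtraction. *)
Lemma sumn_dist_le i js : path ltn i js -> (last i js <= N)%N ->
  (sumn (pairmap dist (f i) (map f js)) + i <= last i js)%N.
Proof.
elim: js i => [|j js IH] i //= /andP[ij jjs] jN.
have jl : (j <= last j js)%N by have := IH j jjs jN; lia.
have := f_lip (ltnW ij) (leq_trans jl jN); have := IH j jjs jN; lia.
Qed.

(** Equality in the telescoped bound forces equality in each term, so the partial sums return the
    positions; these increase strictly, whence neighbours are distinct. *)
Lemma sumn_dist_eq i js : path ltn i js -> (last i js <= N)%N ->
    (last i js <= sumn (pairmap dist (f i) (map f js)) + i)%N ->
  scanl addn i (pairmap dist (f i) (map f js)) = js /\
  path [rel x y | x != y] (f i) (map f js).
Proof.
elim: js i => [|j js IH] i //= /andP[ij jjs] jN lS.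
have le := sumn_dist_le jjs jN.
have jl : (j <= last j js)%N by lia.
have dij := f_lip (ltnW ij) (leq_trans jl jN).
have dE : dist (f i) (f j) = (j - i)%N by lia.
have [|scE pE] := IH j jjs jN; first by lia.
rewrite dE subnKC ?(ltnW ij) // scE pE andbT; split=> //.
by apply/eqP => fij; move: dE; rewrite fij distxx; lia.
Qed.

End Positions.

(** Distinct vertices are at positive distance. The partial sums will serve as positions in
    [tuple_of_surj]. *)
Lemma path_partial_dist k x ys : path [rel x y | x != y] x ys ->
  path ltn k (scanl addn k (pairmap dist x ys)) /\
  last k (scanl addn k (pairmap dist x ys)) = (sumn (pairmap dist x ys) + k)%N.
Proof.
elim: ys x k => //= y ys IH x k /andP[xy /(IH _ (k + dist x y)%N)[-> ->]].
rewrite andbT -addnA [(_ + k)%N]addnC addnCA; split=> //; last by lia.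
rewrite -addn1 leq_add2l lt0n; apply: contra xy => /eqP/dist_eq0 ->.
exact: eqxx.
Qed.

(** Geodesics between consecutive entries are concatenated; each entry is reached after exactly the
    partial sum of the distances up to it. The vertex [a] is the default value of [nth]. *)
Lemma geodesic_through (a x : G) (ys : seq G) : exists p : seq G,
  [/\ path [rel u v | dist u v == 1%N] x p, last x p = last x ys,
      size p = sumn (pairmap dist x ys) &
      map (nth a (x :: p)) (scanl addn 0%N (pairmap dist x ys)) = ys].
Proof.
elim: ys x => [|y ys IH] x; first by exists [::].
have [p [xp xpy sp]] := geodesic_ex x y.
have [q [yq yql sq qE]] := IH y.
exists (p ++ q); split.
- by rewrite cat_path xp xpy.
- by rewrite last_cat xpy.
- by rewrite size_cat sp sq.
rewrite /= add0n; congr cons.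
  by rewrite -cat_cons nth_cat /= sp ltnS leqnn -sp -last_nth.
rewrite -[RHS]qE -[X in scanl _ X _]addn0 scanl_addnDl -map_comp.
apply: eq_map => k /=.
(* For [k = 0] the index points at the junction [y], which is the last entry of [x :: p] and not an
   entry of [q]. *)
rewrite -cat_cons nth_cat /=; case: k => [|k].
  by rewrite addn0 -sp ltnSn -last_nth xpy.
by rewrite -sp addnS ltnS ltnNge leq_addr /= subSS addKn.
Qed.

End Distance.

(** * Sorting the vertices of a simplex by position *)

Section Vertices.
Variables (G : graph) (l : nat).
Implicit Types (u v : vtx G l) (s : {fset vtx G l}) (q : seq (vtx G l)).

Definition before : rel (vtx G l) := [rel u v | (val u.2 < val v.2)%N].

(** The comparison inside [tuple_of], named so that it can be folded. It is only a preorder: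
    vertices with equal positions are tied. *)
Definition by_position : rel (vtx G l) := fun u v => (val u.2 <= val v.2)%N.

Lemma before_trans : transitive before.
Proof. by move=> v u w; apply: ltn_trans. Qed.

Lemma before_irr : irreflexive before.
Proof. by move=> u; apply: ltnn. Qed.

(** Distinct vertices of [s] have distinct positions, so a sort that respects positions is strict. A
    general [e] covers both the given vertex order and [by_position]. *)
Lemma sorted_before_sort (e : rel (vtx G l)) s :
    total e -> transitive e -> subrel e by_position ->
    {in s &, injective snd} ->
  sorted before (sort e (enum_fset s)).
Proof.
move=> e_total e_trans e_pos inj; apply: pairwise_sorted.
set q := sort _ _.
have qs : all (mem s) q by apply/allP => v; rewrite mem_sort.
have qp : pairwise [rel u v | e u v && (u != v)] q.
  rewrite pairwise_relI -sorted_pairwise ?sort_sorted //=.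
  by rewrite -uniq_pairwise sort_uniq fset_uniq.
apply: sub_in_pairwise qs qp => u v us vs /= /andP[/e_pos uv].
rewrite /before /= ltn_neqAle [(_ <= _)%N]uv andbT; apply: contra => /eqP uvE.
by apply/eqP/inj => //; apply: val_inj.
Qed.

Lemma sort_eq_before (e : rel (vtx G l)) s q :
    sorted before (sort e (enum_fset s)) -> sorted before q -> q =i s ->
  sort e (enum_fset s) = q.
Proof.
move=> ss sq qs; apply: irr_sorted_eq before_trans before_irr _ _ ss sq _ => v.
by rewrite mem_sort qs.
Qed.

Lemma sorted_before_by_position s :
  {in s &, injective snd} -> sorted before (sort by_position (enum_fset s)).
Proof.
apply: sorted_before_sort => // [u v|u v w].
  exact: leq_total.
exact: leq_trans.
Qed.

Lemma sorted_before_inj q : sorted before q -> {in q &, injective snd}.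
Proof.
rewrite (sorted_pairwise before_trans).
elim: q => //= w q IH /andP[/allP wq /IH{}IH] u v.
rewrite !inE => /predU1P[->|uq] /predU1P[->|vq] uv //; last exact: IH.
  by have := wq _ vq; rewrite /before /= uv ltnn.
by have := wq _ uq; rewrite /before /= uv ltnn.
Qed.

Lemma sort_by_position_eq s q : sorted before q -> q =i s ->
  sort by_position (enum_fset s) = q.
Proof.
move=> sq qs; apply: sort_eq_before => //; apply: sorted_before_by_position.
by move=> u v; rewrite -!qs; apply: sorted_before_inj.
Qed.

(** Both sorts increase strictly in position, hence give the same list. The signs of the simplicial
    boundary, computed with [r], can thus be read off the tuple. *)
Lemma sort_vtx_by_position (r : rel (vtx G l)) s :
    total r -> transitive r -> antisymmetric r -> subrel before r ->
    {in s &, injective snd} ->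
  sort r (enum_fset s) = sort by_position (enum_fset s).
Proof.
move=> r_total r_trans r_anti r_pos inj; apply: sort_eq_before.
- apply: sorted_before_sort => // u v uv; rewrite /by_position leqNgt.
  apply/negP => vu; have /r_anti uvE : r u v && r v u by rewrite uv r_pos.
  by move: vu; rewrite uvE ltnn.
- exact: sorted_before_by_position.
- by move=> v; rewrite mem_sort.
Qed.

Lemma sort_by_position_fsetD1 s v : {in s &, injective snd} ->
  sort by_position (enum_fset (s `\ v)) =
  rem v (sort by_position (enum_fset s)).
Proof.
move=> inj; rewrite rem_filter ?sort_uniq ?fset_uniq //.
apply: sort_by_position_eq.
  exact/sorted_filter/sorted_before_by_position/inj/before_trans.
by move=> u; rewrite mem_filter mem_sort !inE.
Qed.

End Vertices.

(** * Simplices outside [K'] and tuples of length [l] *)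

Section Tuples.
Variables (G : graph) (hG : connected G) (a b : G) (l : nat).
Implicit Types (s : {fset vtx G l}) (x y : seq G).

Local Notation sorted_vtx s := (sort (@by_position G l) (enum_fset s)).

(** The length of the path witnessing [s] lies between that of the tuple and [l]; the hypothesis
    makes all three equal, and the equality case of the telescoped bound applies. *)
Lemma tuple_of_positions s :
    K hG a b l s -> (l <= len hG (Defs.tuple_of a b s))%N ->
  [/\ scanl addn 0%N (pairmap (dist hG) a (behead (Defs.tuple_of a b s))) =
        rcons [seq val v.2 | v <- sorted_vtx s] l,
      sorted [rel x y | x != y] (Defs.tuple_of a b s) &
      len hG (Defs.tuple_of a b s) = l].
Proof.
move=> [_ inj [[|a' p] //]].
case/and5P=> /= p1 /eqP -> {a'} /eqP pb pp pl ps.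
have ss := sorted_before_by_position inj.
rewrite /Defs.tuple_of -/(@by_position G l) /=.
set q := sorted_vtx s in ss *; set js := [seq val v.2 | v <- q].
pose f := nth a (a :: p).
have fjs : rcons [seq v.1 | v <- q] b = map f (rcons js (size p)).
  rewrite map_rcons /f -last_nth pb /js -map_comp; congr rcons.
  by apply/eq_in_map => v; rewrite mem_sort => /ps[_ /=].
have js_lt : path ltn 0%N (rcons js (size p)).
  rewrite rcons_path path_sortedE; last exact: ltn_trans.
  rewrite sorted_map ss andbT; apply/andP; split.
    by apply/allP => _ /mapP[v _ ->]; have /andP[] := valP v.2.
  have : last 0%N js \in 0%N :: js by apply: mem_last.
  rewrite inE => /predU1P[->|/mapP[v]]; first exact: p1.
  by rewrite mem_sort => /ps[vp _] ->.
have js_last : last 0%N (rcons js (size p)) = size p by rewrite last_rcons.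
have f_lip i j : (i <= j)%N -> (j <= size p)%N ->
  (dist hG (f i) (f j) <= j - i)%N by apply: dist_path_nth.
have lb := sumn_dist_le f_lip js_lt; have ub := sumn_dist_eq f_lip js_lt.
have f0 : f 0%N = a by [].
rewrite js_last leqnn addn0 f0 in lb ub.
rewrite fjs => ls; have pE : size p = l.
  by apply/eqP; rewrite eqn_leq pl (leq_trans ls (lb isT)).
rewrite pE in ls lb ub *.
have [sc ne] := ub isT ls; split=> //.
by apply/eqP; rewrite eqn_leq ls lb.
Qed.

Lemma is_mc_tuple_of n s :
    K hG a b l s -> ~ K' hG a b l s -> #|` s| = n.+1 ->
  is_mc hG a b l n.+2 (Defs.tuple_of a b s).
Proof.
move=> Ks nK's cs.
have ls : (l <= len hG (Defs.tuple_of a b s))%N.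
  by rewrite leqNgt; apply/negP => ls; apply: nK's; split=> //; lia.
have [_ ne sE] := tuple_of_positions Ks ls.
rewrite /is_mc ne sE /= size_rcons size_map size_sort last_rcons.
by rewrite [size _]cs !eqxx.
Qed.

(** With truncated subtraction, [l - 1] is smaller than [l] only when [0 < l]. *)
Lemma is_mc_tuple_ofN n s : (0 < l)%N ->
  K' hG a b l s -> ~~ is_mc hG a b l n (Defs.tuple_of a b s).
Proof.
by move=> l0 [_ Ls]; apply/negP => /and5P[_ _ _ _ /eqP sE]; move: Ls; lia.
Qed.

(** The entries of the tuple give the vertices and, at length [l], the partial sums of its distances
    give their positions. The length bound passes to [s'] because the tuples agree. *)
Lemma tuple_of_inj s s' :
    K hG a b l s -> K hG a b l s' -> (l <= len hG (Defs.tuple_of a b s))%N ->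
  Defs.tuple_of a b s = Defs.tuple_of a b s' -> s = s'.
Proof.
move=> Ks Ks' Ls ss'.
have Ls' := Ls; rewrite ss' in Ls'.
have [posE _ _] := tuple_of_positions Ks Ls.
have [posE' _ _] := tuple_of_positions Ks' Ls'.
rewrite ss' posE' in posE; have {posE posE'} [posE] := rcons_inj posE.
have [fstE] := rcons_inj (congr1 behead ss').
have : sorted_vtx s = sorted_vtx s'.
  apply: (@inj_map _ _ (fun v : vtx G l => (v.1, val v.2))).
    by move=> [u i] [v j] /= [-> /val_inj ->].
  by rewrite -!(zip_map fst (fun v : vtx G l => val v.2)) posE [map _ _]fstE.
move=> sE; apply/fsetP => v.
by rewrite -(mem_sort (@by_position G l)) sE mem_sort.
Qed.

(** The simplex consists of the inner entries of [x], paired with the positions at which a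
    concatenation of geodesics meets them. *)
Lemma tuple_of_surj n x : is_mc hG a b l n.+2 x ->
  exists s, [/\ K hG a b l s, #|` s| = n.+1 & Defs.tuple_of a b s = x].
Proof.
case: x => [|a' x] // /and5P[/eqP /= sx /eqP -> {a'}].
case/lastP: x sx => [|xs b'] //; rewrite size_rcons last_rcons.
move=> [sx] /eqP -> {b'} ne /eqP Lx.
have [p [ap pb sp pE]] := geodesic_through hG a a (rcons xs b).
have [ps_lt ps_last] := path_partial_dist hG 0%N ne.
rewrite Lx addn0 in sp ps_last.
(* The last partial sum is [l], belonging to [b]; the others, [js], are the positions of the inner
   entries [xs]. *)
case/lastP: (scanl _ _ _) ps_lt ps_last pE => [|js j]; first by case: (xs).
rewrite last_rcons map_rcons => js_lt jl /rcons_inj[xsE _].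
rewrite {j}jl in js_lt.
have js_sorted : sorted ltn js.
  by move: js_lt; rewrite rcons_path => /andP[/path_sorted].
(* The strict chain from 0 through [js] to [l] puts every position in the range required by
   [pos l]. *)
have /andP[l_gt0] : (0 < l)%N && all (fun j => 0 < j < l)%N js.
  move: js_lt; rewrite path_pairwise; last exact: ltn_trans.
  rewrite -rcons_cons pairwise_rcons pairwise_cons.
  move=> /andP[/andP[l0 hi] /andP[lo _]].
  rewrite [(0 < l)%N]l0 (eq_all (a2 := predI (ltn 0%N) (fun j => j < l)%N)) //.
  by rewrite all_predI lo.
case/all_sigP=> ps jsE; rewrite {}jsE in js_sorted xsE js_lt.
pose q : seq (vtx G l) := [seq (nth a (a :: p) (val i), i) | i : pos l <- ps].
have sq : sorted (@before G l) q.
  by rewrite sorted_map; rewrite sorted_map in js_sorted.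
pose s := [fset v in q].
have qs : q =i s by move=> v; rewrite !inE.
have sE := sort_by_position_eq sq qs.
have fq : [seq v.1 | v <- q] = xs by rewrite -xsE -!map_comp.
have cs : #|` s| = n.+1 by rewrite -sx -fq size_map -sE size_sort.
exists s; split=> //; last first.
  by rewrite /Defs.tuple_of -/(@by_position G l) [sort _ _]sE fq.
split.
- by rewrite -cardfs_gt0 cs.
- by move=> u v; rewrite -!qs; apply: sorted_before_inj.
exists (a :: p).
  by rewrite /is_path /= eqxx pb last_rcons eqxx ap sp leqnn !andbT.
move=> v; rewrite -qs => /mapP[i _ ->] /=; split=> //.
by rewrite sp; have /andP[] := valP i.
Qed.

End Tuples.

(** Removing an inner entry replaces two distances by one, so the length is preserved exactly when
    the removal is smooth. *)
Lemma len_omit (G : graph) (hG : connected G) (a : G) i (s : seq G) :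
    (i.+2 < size s)%N ->
  (len hG (omit i.+1 s) + (dist hG (nth a s i) (nth a s i.+1) +
     dist hG (nth a s i.+1) (nth a s i.+2)) =
   len hG s + dist hG (nth a s i) (nth a s i.+2))%N.
Proof.
elim: i s => [|i IH] [|w [|x [|y s]]] //= si.
  by rewrite /omit /= ?drop0; lia.
have := IH [:: x, y & s] si; rewrite /omit /=; lia.
Qed.

(** * Additive maps on free and relative chains *)

Lemma freeg_additive_eq (X : choiceType) (V : zmodType)
    (f g : {additive {freeg X / int} -> V}) :
  (forall z, f << z >> = g << z >>) -> f =1 g.
Proof.
move=> fg D; rewrite -[D]freeg_sumE !raddf_sum; apply: eq_bigr => z _.
by rewrite -[coeff z D]intz -freegU_mulz !raddfMz fg.
Qed.

Definition additive_of (V W : zmodType) (f : V -> W) (h : zmod_morphism f) :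
  {additive V -> W} := HB.pack f (GRing.isZmodMorphism.Build V W f h).

Section RelativeChains.
Variables (T : choiceType) (S S' : scomplex T).

Lemma nsimplexP n (s : nsimplex S n) : S (val s) /\ #|` val s| = n.+1.
Proof. by have /andP[/asboolP Ss /eqP cs] := valP s. Qed.

Lemma supportedU n (s : nsimplex S n) :
  S' (val s) -> << s >> \in @supported _ S S' n.
Proof. by move=> S's; rewrite inE /= domU1 /= andbT; apply/asboolP. Qed.

Lemma cls_supported n (c : chain S n) :
  c \in @supported _ S S' n -> cls S' c = 0.
Proof.
move=> hc; rewrite -[RHS](raddf0 (@cls _ S S' n)).
by apply/eqP; rewrite /cls -Quotient.idealrBE subr0.
Qed.

Lemma relchainP n (c : relchain S S' n) : exists d : chain S n, c = cls S' d.
Proof.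
exists (repr (c : {ideal_quot (@supported _ S S' n)})).
by rewrite /cls reprK.
Qed.

End RelativeChains.

(** * The map on chains, its signs and its descent to relative chains *)

Section ChainMap.
Variables (G : graph) (hG : connected G) (a b : G) (l : nat).
Hypothesis l_gt0 : (0 < l)%N.
Implicit Types (s : {fset vtx G l}).

HB.instance Definition _ k :=
  GRing.isZmodMorphism.Build (MC hG a b l k.+1) (MC hG a b l k)
    (@mc_bd G hG a b l k)
    (lift_is_additive (fun s : mc_gen hG a b l k.+1 =>
       \sum_(i < k) (-1) ^+ i.+1 *: mc_face s i)).

(* Sequences that do not generate MC are sent to 0, so that a face of a tuple and
   a simplex of K' need no case distinction. *)
Definition tuple_chain k (x : seq G) : MC hG a b l k :=
  oapp (fun y : mc_gen hG a b l k => << y >>) 0 (insub x).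

Lemma tuple_chain_val k (y : mc_gen hG a b l k) :
  tuple_chain k (val y) = << y >>.
Proof. by rewrite /tuple_chain valK. Qed.

Lemma tuple_chain0 k x : ~~ is_mc hG a b l k x -> tuple_chain k x = 0.
Proof. by move=> x_mc; rewrite /tuple_chain insubN. Qed.

(** A removal that is not smooth changes the length, so the shorter tuple is no generator and
    [tuple_chain] returns 0, as [mc_face] does. *)
Lemma mc_faceE k (y : mc_gen hG a b l k.+1) (i : 'I_k) :
  mc_face y i = tuple_chain k (omit i.+1 (val y)).
Proof.
rewrite /mc_face; case: {-}_ / idP => [h|nsm].
  by rewrite -tuple_chain_val.
rewrite tuple_chain0 //; apply/negP => /and5P[_ _ _ _ /eqP oE]; case: nsm.
have /and5P[/eqP sy _ _ _ /eqP yE] := valP y.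
have := @len_omit G hG a i (val y).
rewrite sy !ltnS oE yE => /(_ (ltn_ord i)) /addnI dE.
by rewrite /smooth /= dE.
Qed.

(** Defined first on absolute chains; it kills those supported in [K'] and so passes to the
    quotient. *)
Definition simplex_map n : chain (K hG a b l) n -> MC hG a b l n.+2 :=
  fglift (fun s : nsimplex (K hG a b l) n =>
    tuple_chain n.+2 (Defs.tuple_of a b (val s))).

HB.instance Definition _ n :=
  GRing.isZmodMorphism.Build (chain (K hG a b l) n) (MC hG a b l n.+2)
    (@simplex_map n)
    (lift_is_additive (fun s : nsimplex (K hG a b l) n =>
       tuple_chain n.+2 (Defs.tuple_of a b (val s)))).

Lemma simplex_mapU n (s : nsimplex (K hG a b l) n) :
  simplex_map << s >> = tuple_chain n.+2 (Defs.tuple_of a b (val s)).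
Proof. by rewrite /simplex_map liftU scale1r. Qed.

Lemma simplex_mapU_mc n (s : nsimplex (K hG a b l) n) :
    ~ K' hG a b l (val s) ->
  exists2 y : mc_gen hG a b l n.+2, val y = Defs.tuple_of a b (val s) &
    simplex_map << s >> = << y >>.
Proof.
have [Ks cs] := nsimplexP s => nK's.
exists (Sub _ (is_mc_tuple_of Ks nK's cs)) => //.
by rewrite simplex_mapU -tuple_chain_val.
Qed.

Lemma simplex_mapU0 n (s : nsimplex (K hG a b l) n) :
  K' hG a b l (val s) -> simplex_map << s >> = 0.
Proof. by move=> K's; rewrite simplex_mapU tuple_chain0 ?is_mc_tuple_ofN. Qed.

Lemma simplex_map_supported n (c : chain (K hG a b l) n) :
  c \in @supported _ (K hG a b l) (K' hG a b l) n -> simplex_map c = 0.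
Proof.
move=> /allP hc; rewrite -[c]freeg_sumE raddf_sum big_seq.
apply: big1 => s /hc /asboolP K's.
by rewrite -[coeff s c]intz -freegU_mulz raddfMz /= simplex_mapU0 ?mul0rz.
Qed.

(** The successor of the index accounts for [a] at the head of the tuple. *)
Lemma omit_tuple_of s v : {in s &, injective snd} -> v \in s ->
  Defs.tuple_of a b (s `\ v) =
  omit (index v (sort (@by_position G l) (enum_fset s))).+1
    (Defs.tuple_of a b s).
Proof.
move=> inj vs; rewrite /Defs.tuple_of -/(@by_position G l).
rewrite [sort _ (enum_fset (s `\ v))]sort_by_position_fsetD1 //.
set q := sort _ _.
have vq : (index v q < size q)%N by rewrite index_mem mem_sort.
rewrite remE /omit /= map_cat map_take map_drop -!cats1 -catA.
rewrite -(size_map fst) in vq; congr (_ :: _); rewrite takel_cat ?(ltnW vq) //.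
congr (_ ++ _); rewrite drop_cat.
(* If [v] is last in [q], only [b] remains after it. *)
case: ltnP => // qv; suff -> : (index v q).+1 = size (map fst q).
  by rewrite drop_size subnn.
by apply/eqP; rewrite eqn_leq vq qv.
Qed.

(** Summing along the sorted list replaces each vertex by its rank [i], which is also the exponent
    of its sign. *)
Lemma sum_faces (r : rel (vtx G l)) n s :
    total r -> transitive r -> antisymmetric r ->
    (forall u v : vtx G l, (val u.2 < val v.2)%N -> r u v) ->
    {in s &, injective snd} -> #|` s| = n.+2 ->
  \sum_(v <- enum_fset s) (-1) ^+ index v (sort r (enum_fset s)) *:
     tuple_chain n.+2 (Defs.tuple_of a b (s `\ v)) =
  \sum_(i < n.+2) (-1) ^+ i *:
     tuple_chain n.+2 (omit i.+1 (Defs.tuple_of a b s)).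
Proof.
move=> r_total r_trans r_anti r_pos inj cs.
rewrite (sort_vtx_by_position r_total r_trans r_anti r_pos inj).
rewrite -(perm_big _ (permEl (perm_sort (@by_position G l) _))) /=.
set q := sort _ _; have sq : size q = n.+2 by rewrite size_sort -cs.
have /fset0Pn[v0 _] : s != fset0 by rewrite -cardfs_gt0 cs.
rewrite (big_nth v0) sq big_mkord; apply: eq_bigr => i _.
have iq : (i < size q)%N by rewrite sq.
rewrite index_uniq ?sort_uniq ?fset_uniq // omit_tuple_of //.
  by rewrite [index _ _]index_uniq ?sort_uniq ?fset_uniq.
by rewrite -[_ \in s](mem_sort (@by_position G l)) mem_nth.
Qed.

Lemma simplex_map_bd (r : rel (vtx G l)) n (s : nsimplex (K hG a b l) n.+1) :
    total r -> transitive r -> antisymmetric r ->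
    (forall u v : vtx G l, (val u.2 < val v.2)%N -> r u v) ->
  - simplex_map (bd r << s >>) = mc_bd (simplex_map << s >>).
Proof.
move=> r_total r_trans r_anti r_pos.
have [Ks cs] := nsimplexP s; have [_ inj _] := Ks.
have [K's|nK's] := pselect (K' hG a b l (val s)).
  (* [K'] is closed under faces, so both sides vanish. *)
  rewrite simplex_mapU0 // simplex_map_supported ?raddf0 ?oppr0 //.
  exact/bd_supported/supportedU.
have -> : simplex_map (bd r << s >>) =
    \sum_(i < n.+2) (-1) ^+ i *:
      tuple_chain n.+2 (omit i.+1 (Defs.tuple_of a b (val s))).
  rewrite -(sum_faces r_total r_trans r_anti r_pos inj cs) big_seq_fsetE /=.
  rewrite /bd liftU scale1r /bd_simplex raddf_sum /=; apply: eq_bigr => v _.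
  by rewrite -[_ ^+ _]intz !scaler_int raddfMz /= simplex_mapU.
have [y yE ->] := simplex_mapU_mc nK's.
rewrite /mc_bd liftU scale1r -sumrN; apply: eq_bigr => i _.
(* Rank [i] in the simplex is position [i.+1] in the tuple; this shift is the reason for the
   opposite sign of the simplicial differential. *)
by rewrite exprS mulN1r scaleNr mc_faceE yE.
Qed.

Lemma simplex_map_repr n (c : chain (K hG a b l) n) :
  simplex_map (repr (cls (K' hG a b l) c :
    {ideal_quot (@supported _ (K hG a b l) (K' hG a b l) n)})) = simplex_map c.
Proof.
apply/eqP; rewrite -subr_eq0 -raddfB /=; apply/eqP/simplex_map_supported.
by rewrite Quotient.idealrBE reprK.
Qed.

Lemma rel_simplex_map_is_zmod_morphism n :
  zmod_morphism (fun c : relchain (K hG a b l) (K' hG a b l) n =>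
    simplex_map (repr (c :
      {ideal_quot (@supported _ (K hG a b l) (K' hG a b l) n)}))).
Proof.
move=> c c'; have [d ->] := relchainP c; have [d' ->] := relchainP c'.
by rewrite -raddfB !simplex_map_repr raddfB.
Qed.

Definition rel_simplex_map n :
    {additive relchain (K hG a b l) (K' hG a b l) n -> MC hG a b l n.+2} :=
  additive_of (@rel_simplex_map_is_zmod_morphism n).

Lemma rel_simplex_map_sends : sends_simplex_to_tuple rel_simplex_map.
Proof.
move=> n s /simplex_mapU_mc[y yE sE]; exists y => //.
by rewrite -sE; apply: simplex_map_repr.
Qed.

(** * Properties of any map with the prescribed values *)

Section Uniqueness.
Variable t : forall n,
  {additive relchain (K hG a b l) (K' hG a b l) n -> MC hG a b l n.+2}.
Hypothesis t_sends : sends_simplex_to_tuple t.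

(** The values of [t] are prescribed only outside [K'], but simplices of [K'] have class zero, so
    generators determine [t]. *)
Lemma sends_simplex_map n (c : chain (K hG a b l) n) :
  t n (cls (K' hG a b l) c) = simplex_map c.
Proof.
pose f := t n \o @cls _ (K hG a b l) (K' hG a b l) n.
apply: (@freeg_additive_eq _ _ f (@simplex_map n)) => s; rewrite /f /=.
have [K's|nK's] := pselect (K' hG a b l (val s)).
  by rewrite cls_supported ?supportedU // raddf0 simplex_mapU0.
have [x xE ->] := t_sends nK's; have [y yE ->] := simplex_mapU_mc nK's.
by congr << _ >>; apply: val_inj; rewrite xE yE.
Qed.

(** A simplex [sg y] is chosen for each generator [y]; the additive extension of [sg], followed by
    [cls], is the inverse. *)
Lemma sends_bijective n : bijective (t n).
Proof.
have /choice[sg sgE] (y : mc_gen hG a b l n.+2) :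
    exists s : nsimplex (K hG a b l) n, Defs.tuple_of a b (val s) = val y.
  have [s [Ks cs sy]] := tuple_of_surj (valP y).
  have sP : `[< K hG a b l s >] && (#|` s| == n.+1).
    by rewrite cs eqxx andbT; apply/asboolP.
  by exists (Sub s sP).
pose U : MC hG a b l n.+2 -> chain (K hG a b l) n :=
  fglift (fun y => << sg y >>).
pose Ua : {additive _ -> _} :=
  additive_of (lift_is_additive (fun y => << sg y >> : chain (K hG a b l) n)
    : zmod_morphism U).
pose cl := @cls _ (K hG a b l) (K' hG a b l) n.
have UU y : Ua << y >> = << sg y >> by rewrite /= /U liftU scale1r.
exists (cl \o Ua).
  move=> c; have [d ->] := relchainP c; rewrite sends_simplex_map.
  apply: (@freeg_additive_eq _ _ (cl \o Ua \o @simplex_map n) cl) => s /=.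
  (* On [K'] both sides are 0; elsewhere [sg y] and [s] have the same tuple of length [l], hence are
     equal. *)
  have [K's|nK's] := pselect (K' hG a b l (val s)).
    rewrite simplex_mapU0 // [RHS]cls_supported ?supportedU //.
    by rewrite -[U 0]/(Ua 0) !raddf0.
  have [y yE ->] := simplex_mapU_mc nK's; rewrite [U _]UU; congr (cl << _ >>).
  have [Ks _] := nsimplexP s; have [Ks' _] := nsimplexP (sg y).
  have /and5P[_ _ _ _ /eqP Ly] := valP y.
  by apply/val_inj/(tuple_of_inj Ks' Ks); rewrite sgE ?Ly.
move=> c; rewrite /= sends_simplex_map.
apply: (@freeg_additive_eq _ _ (@simplex_map n \o Ua) idfun) => y /=.
by rewrite [U _]UU simplex_mapU sgE tuple_chain_val.
Qed.

(** Both sides are additive in a representative of [c], which reduces the identity to single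
    simplices. *)
Lemma sends_chain_map (r : rel (vtx G l)) n
    (c : relchain (K hG a b l) (K' hG a b l) n.+1) :
    total r -> transitive r -> antisymmetric r ->
    (forall u v : vtx G l, (val u.2 < val v.2)%N -> r u v) ->
  t n (- rel_bd r c) = mc_bd (t n.+1 c).
Proof.
move=> r_total r_trans r_anti r_pos; have [d ->] := relchainP c.
rewrite rel_bdE raddfN /= !sends_simplex_map.
apply: (@freeg_additive_eq _ _ (-%R \o @simplex_map n \o @bd _ r _ n)
  (@mc_bd _ _ _ _ _ _ \o @simplex_map n.+1)) => s.
exact: simplex_map_bd.
Qed.

End Uniqueness.

End ChainMap.

Theorem theorem4p2 (G : graph) (hG : connected G) (a b : G) (l : nat)
    (r : rel (vtx G l))
    (r_total : total r) (r_trans : transitive r) (r_anti : antisymmetric r)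
    (r_pos : forall u v : vtx G l, (val u.2 < val v.2)%N -> r u v)
    (hl : (3 <= l)%N) (hd : (dist hG a b <= l)%N) :
  (exists t : forall n, {additive relchain (K hG a b l) (K' hG a b l) n ->
                                  MC hG a b l n.+2},
      sends_simplex_to_tuple t) /\
  (forall t : forall n, {additive relchain (K hG a b l) (K' hG a b l) n ->
                                  MC hG a b l n.+2},
      sends_simplex_to_tuple t ->
      (forall n (c : relchain (K hG a b l) (K' hG a b l) n.+1),
          t n (- rel_bd r c) = mc_bd (t n.+1 c)) /\
      (forall n, bijective (t n))).
Proof.
have l_gt0 : (0 < l)%N by apply: leq_trans hl.
split.
  by exists (rel_simplex_map hG a b l_gt0); apply: rel_simplex_map_sends.
move=> t t_sends; split=> n; last exact: sends_bijective.
by move=> c; apply: sends_chain_map.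
Qed.
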